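(* Let $\{S_i\}_{i\in\mathbb{N}}$ be an infinite iterated function system on $[0,2]^d$ such that $S_i([0,2]^d)\subseteq[0,1]^d$ for all $i\in\mathbb{N}$ and such that the contraction ratios of the maps $S_i$ accumulate only at zero. Let $V=[0,1)^d$ and let $\mu=\prod_{i\in\mathbb{N}}\mathcal{L}^d|_V$ be the infinite product probability measure on $V^{\mathbb{N}}$. For $t=(t_1,t_2,\ldots)\in V^{\mathbb{N}}$ let $F_t$ be the attractor of the IIFS $\{S_i+t_i\}_{i\in\mathbb{N}}$ on $[0,2]^d$. Then for $\mu$-almost all $t\in V^{\mathbb{N}}$, the attractor $F_t$ is somewhere dense in $[0,2]^d$, so for all $\theta\in(0,1]$, $$\dim_{\theta}F_t=\dim_{\mathrm B}F_t=d.$$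
   Context: An infinite iterated function system (IIFS) on a compact connected set $X\subset\mathbb{R}^d$ with more than one point is a countable collection of maps $S_i\colon X\to X$ for which there is $\rho\in[0,1)$ with $\|S_i(x)-S_i(y)\|\le\rho\|x-y\|$ for all $x,y\in X$ and all $i$ (Euclidean norm). Its limit set (attractor) is $F=\bigcup_{w\in\mathbb{N}^{\mathbb{N}}}\bigcap_{n=1}^\infty S_{w_1}\circ\cdots\circ S_{w_n}(X)$ when the index set is $\mathbb{N}$. The contraction ratio of $S_i$ is its smallest Lipschitz constant; that the contraction ratios accumulate only at zero means that the sequence of ratios has $0$ as its only accumulation point (i.e. it tends to $0$). $(S_i+t_i)(x)=S_i(x)+t_i$ for $x\in[0,2]^d$. $\mathcal{L}^d$ is Lebesgue measure. A set is somewhere dense if its closure has non-empty interior. For $\theta\in(0,1]$ and non-empty bounded $E\subset\mathbb{R}^d$: $\overline{\dim}_{\theta}E$ is the infimum of $s\ge0$ such that for all $\epsilon>0$ there is $\delta_0\in(0,1]$ such that for all $\delta\in(0,\delta_0)$ there is a cover $\{U_1,U_2,\ldots\}$ of $E$ with diameters $\delta^{1/\theta}\le|U_i|\le\delta$ for all $i$ and $\sum_i|U_i|^s\le\epsilon$; $\underline{\dim}_{\theta}E$ is the infimum of $s\ge0$ such that for all $\epsilon>0$ and $\delta_0\in(0,1]$ there exist $\delta\in(0,\delta_0)$ and a cover with the same properties. $\dim_\theta E$ (respectively the box dimension $\dim_{\mathrm B}E$) denotes the common value when the upper and lower versions coincide; the claim includes that they do. *)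

(* Defs.v *)
From mathcomp Require Import all_boot all_order all_algebra.
From mathcomp Require Import all_classical all_reals all_analysis.

Set Implicit Arguments.
Unset Strict Implicit.
Unset Printing Implicit Defensive.

Import Order.TTheory GRing.Theory Num.Theory.
Import numFieldNormedType.Exports.

Local Open Scope classical_set_scope.
Local Open Scope ring_scope.

Section Euclidean.
Context {R : realType} {d : nat}.
Implicit Types (x y : 'rV[R]_d) (U X : set 'rV[R]_d).

(* The library norm on 'rV[R]_d is the sup norm (same topology). *)
Definition enorm x : R := Num.sqrt (\sum_j x 0 j ^+ 2).

(* diam set0 = -oo *)
Definition diam U : \bar R :=
  ereal_sup [set (enorm (x - y))%:E | x in U & y in U].

Definition lipschitz_with X (f : 'rV[R]_d -> 'rV[R]_d) (k : R) : Prop :=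
  forall x y, X x -> X y -> enorm (f x - f y) <= k * enorm (x - y).

Definition contraction_ratio X (f : 'rV[R]_d -> 'rV[R]_d) : R :=
  inf [set k | 0 <= k /\ lipschitz_with X f k].

Definition somewhere_dense X : Prop := (closure X)° !=set0.

End Euclidean.

Definition closed_cube {R : realType} {d : nat} (a b : R) : set 'rV[R]_d :=
  [set x | forall j, a <= x 0 j <= b].

Definition half_open_cube {R : realType} {d : nat} (a b : R) : set 'rV[R]_d :=
  [set x | forall j, a <= x 0 j < b].

Section IIFS.
Context {R : realType} {d : nat}.
Implicit Types (X : set 'rV[R]_d) (S : nat -> 'rV[R]_d -> 'rV[R]_d).

(* A map X -> X is represented by a total function on 'rV[R]_d that preserves
   X; its values outside X are irrelevant. *)
Definition is_iifs X S : Prop :=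
  [/\ compact X, connected X, (exists x y, [/\ X x, X y & x != y]),
      (forall i, S i @` X `<=` X) &
      exists rho : R, 0 <= rho < 1 /\ forall i, lipschitz_with X (S i) rho].

(* S_(w 0) \o ... \o S_(w (n - 1)) *)
Fixpoint word_comp S (w : nat -> nat) (n : nat) : 'rV[R]_d -> 'rV[R]_d :=
  if n is m.+1 then word_comp S w m \o S (w m) else id.

Definition limit_set X S : set 'rV[R]_d :=
  \bigcup_(w in [set: nat -> nat])
    \bigcap_(n in [set n | (1 <= n)%N]) (word_comp S w n @` X).

Definition translate S (t : nat -> 'rV[R]_d) (i : nat) (x : 'rV[R]_d) :=
  S i x + t i.

End IIFS.

Section Dimensions.
Context {R : realType} {d : nat}.
Implicit Types (E : set 'rV[R]_d) (theta delta s eps : R).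

(* A countable (finite or infinite) cover of E, indexed by I. *)
Definition admissible_cover E theta delta s eps : Prop :=
  exists (I : set nat) (U : nat -> set 'rV[R]_d),
    [/\ E `<=` \bigcup_(i in I) U i,
        (forall i, I i ->
           ((delta `^ theta^-1)%:E <= diam (U i) <= delta%:E)%E) &
        (\esum_(i in I) (diam (U i) `^ s) <= eps%:E)%E].

Definition upper_intermediate_dim theta E : \bar R :=
  ereal_inf [set s%:E | s in [set s | 0 <= s /\
    forall eps, 0 < eps -> exists delta0, 0 < delta0 <= 1 /\
      forall delta, 0 < delta < delta0 ->
        admissible_cover E theta delta s eps]].

Definition lower_intermediate_dim theta E : \bar R :=
  ereal_inf [set s%:E | s in [set s | 0 <= s /\
    forall eps delta0, 0 < eps -> 0 < delta0 <= 1 ->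
      exists delta, 0 < delta < delta0 /\
        admissible_cover E theta delta s eps]].

Definition has_intermediate_dim theta E (v : \bar R) : Prop :=
  upper_intermediate_dim theta E = v /\ lower_intermediate_dim theta E = v.

(* The least number of sets of diameter at most delta that cover E. *)
Definition covering_number delta E : \bar R :=
  ereal_inf [set n%:R%:E | n in [set n : nat |
    exists U : 'I_n -> set 'rV[R]_d,
      E `<=` \bigcup_(i in [set: 'I_n]) U i /\
      forall i, (diam (U i) <= delta%:E)%E]].

Definition box_quotient E delta : \bar R :=
  (lne (covering_number delta E) * ((- ln delta)^-1)%:E)%E.

Definition upper_box_dim E : \bar R := limf_esup (box_quotient E) 0^'+.

Definition lower_box_dim E : \bar R := limf_einf (box_quotient E) 0^'+.

Definition has_box_dim E (v : \bar R) : Prop :=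
  upper_box_dim E = v /\ lower_box_dim E = v.

End Dimensions.

(* The d-dimensional Lebesgue measure of a Borel set, as the d-fold product of the
   one-dimensional one: the integral of the measures of the sections. *)
Fixpoint lebesgue_rV {R : realType} (d : nat) : set 'rV[R]_d -> \bar R :=
  match d with
  | 0 => fun A => (\1_A (0 : 'rV[R]_0))%:E
  | n.+1 => fun A => (\int[@lebesgue_measure R]_x
      lebesgue_rV [set v : 'rV[R]_n | A (row_mx (x%:M : 'rV[R]_1) v)])%E
  end.

(* L^d restricted to V = [0,1)^d. *)
Definition lebesgue_unit_cube {R : realType} (d : nat) (A : set 'rV[R]_d) :
    \bar R :=
  lebesgue_rV (A `&` half_open_cube 0 1).

Section InfiniteProduct.
Context {R : realType} {d : nat}.

Definition borel_rV : set (set 'rV[R]_d) := <<s open >>.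

Definition coordinate_cylinders : set (set (nat -> 'rV[R]_d)) :=
  [set C | exists n A, borel_rV A /\ C = [set t | A (t n)]].

(* Sequences in R^d with the product sigma-algebra. *)
Definition seq_rV := g_sigma_algebraType coordinate_cylinders.

(* mu is the product of countably many copies of P: this determines mu, since
   the sets on the left form a pi-system generating the sigma-algebra. *)
Definition is_infinite_product (P : set 'rV[R]_d -> \bar R)
    (mu : probability seq_rV R) : Prop :=
  forall (n : nat) (A : nat -> set 'rV[R]_d), (forall i, borel_rV (A i)) ->
    mu [set t | forall i, (i < n)%N -> A i (t i)] = (\prod_(i < n) P (A i))%E.

End InfiniteProduct.

(* Main.v *)
From mathcomp Require Import finmap.
Require Import Defs.
From mathcomp Require Import all_boot all_order all_algebra.
From mathcomp Require Import all_classical all_reals all_analysis.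
From mathcomp Require Import measurable_realfun ring lra.

Set Implicit Arguments.
Unset Strict Implicit.
Unset Printing Implicit Defensive.

Import Order.TTheory GRing.Theory Num.Theory.
Import numFieldNormedType.Exports.

Local Open Scope classical_set_scope.
Local Open Scope ring_scope.

(** The limit set [F] of the translated system [S_i + t_i] is mapped into itself
    by every [S_i + t_i] and is not empty, since it contains the fixed point of
    any of these contractions.  Hence [F] contains the points [S_i x + t_i] for
    one fixed [x] in [F] and all [i].

    The sets [S_i X], with [X] the cube [[0,2]^d], have diameters tending to
    [0], and they stay in a compact set; so there is a point [c] such that
    [S_i X] lies as close to [c] as wanted for infinitely many [i]
    ([images_recur]).  For such [i] the point [S_i x + t_i] is almost [c + t_i].
    The [t_i] are independent and uniform in the unit cube, and a fixed small
    box has the same positive probability for every [i]; by the easy argument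
    behind the second Borel-Cantelli lemma, almost surely each box of each grid
    contains a [t_i] with [i] among these indices ([ae_translations_hit]).
    Thus [F] is dense in the cube [c + (0,1)^d] ([limit_set_dense]).

    The dimensions are then determined, whatever the randomness.  The upper
    bounds come from covering [[0,2]^d] by about [delta^-d] cubes of diameter
    exactly [delta] ([cube_grid_cover]); the exact value matters because for
    [theta = 1] no other diameter is allowed.  The lower bounds come from a
    volume inequality: sets of diameters [l_i] that cover a dense subset of a
    ball of radius [h] satisfy [h^d <= sum_i (3 l_i)^d]
    ([dense_cover_volume]).  When all [l_i <= 1] and [s < d] this bounds
    [sum_i l_i^s] from below, and when all [l_i <= delta] it bounds the number
    of sets from below by a multiple of [delta^-d]. *)

(** * Coordinates and compactness *)

(** Neighbourhoods are described coordinatewise because the Euclidean norm, in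
    which the maps contract, is compared with the sup norm only through
    coordinates. *)
Lemma nbhs_rVP {R : realType} {d : nat} (x : 'rV[R]_d) (A : set 'rV[R]_d) :
  nbhs x A <-> exists2 e : R, 0 < e &
    forall y : 'rV[R]_d, (forall j, `|x 0 j - y 0 j| < e) -> A y.
Proof.
rewrite nbhs_ballP; split=> -[e /= e0 eA]; exists e => //= y.
  move=> xy; apply: eA; split => // i j; rewrite ord1 -ball_normE.
  exact: xy.
by move=> [_ xy]; apply: eA => j; have := xy 0 j; rewrite -ball_normE.
Qed.

Lemma compact_sequence_recurs {R : realType} {d : nat} (X : set 'rV[R]_d)
    (u : nat -> 'rV[R]_d) :
  compact X -> (forall n, X (u n)) ->
  exists2 c, X c & forall e : R, 0 < e -> forall N, exists2 n, (N <= n)%N &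
    forall j, `|c 0 j - u n 0 j| < e.
Proof.
move=> cX Xu.
have [|c [Xc clc]] := cX (u @ \oo) _; first by exists 0%N => //= n _; exact: Xu.
exists c => // e e0 N.
have := clc [set u n | n in [set n | (N <= n)%N]]
  [set y | forall j, `|c 0 j - y 0 j| < e].
case; first by exists N => //= n Nn; exists n.
  by apply/nbhs_rVP; exists e.
by move=> _ [[n /= Nn <-] un]; exists n.
Qed.

Lemma coord_le_enorm {R : realType} {d : nat} (x : 'rV[R]_d) j :
  `|x 0 j| <= enorm x.
Proof.
rewrite -sqrtr_sqr ler_wsqrtr// (bigD1 j)//= lerDl.
by apply: sumr_ge0 => i _; exact: sqr_ge0.
Qed.

Lemma enorm_le {R : realType} {d : nat} (x : 'rV[R]_d) (r : R) :
  0 <= r -> (forall j, `|x 0 j| <= r) -> enorm x <= Num.sqrt d%:R * r.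
Proof.
move=> r0 xr.
have -> : Num.sqrt d%:R * r = Num.sqrt (d%:R * r ^+ 2).
  by rewrite sqrtrM ?ler0n// sqrtr_sqr ger0_norm.
rewrite ler_wsqrtr// mulr_natl -[X in _ *+ X]card_ord -sumr_const.
by apply: ler_sum => j _; rewrite -real_normK ?num_real// ler_pXn2r// nnegrE.
Qed.

(** A Euclidean contraction need not contract the sup norm, so the fixed point
    is obtained from compactness: the iterates [u_n] of a point satisfy
    [|u_n - u_(n+1)| <= rho^n C], so a cluster point of them is fixed by [T]. *)
Lemma lipschitz_fixed_point {R : realType} {d : nat} (X : set 'rV[R]_d) T
    (rho : R) :
  compact X -> X !=set0 -> T @` X `<=` X -> 0 <= rho < 1 ->
  lipschitz_with X T rho -> exists2 p, X p & T p = p.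
Proof.
move=> cX [x0 Xx0] TX /andP[rho0 rho1] lipT.
pose u n := iter n T x0.
have Xu n : X (u n) by elim: n => [//|n IH] /=; apply: TX; exists (u n).
have [p Xp clp] := compact_sequence_recurs cX Xu; exists p => //.
pose C := enorm (u 0%N - u 1%N).
have step n : enorm (u n - u n.+1) <= rho ^+ n * C.
  elim: n => [|n IH]; first by rewrite expr0 mul1r.
  rewrite exprS -mulrA; apply: le_trans (ler_wpM2l rho0 IH).
  exact: (lipT (u n) (u n.+1) (Xu n) (Xu n.+1)).
(* Each of the three distances p to u_n, u_n to u_(n+1) and u_(n+1) to T p is
   made at most e / 3; D + 1 compares the sup and the Euclidean norms. *)
apply/rowP => j; apply/eqP; rewrite -subr_eq0 -normr_le0.
apply/ler_addgt0Pr => e e0; rewrite add0r.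
pose D := Num.sqrt (d%:R : R).
have D0 : 0 <= D by exact: sqrtr_ge0.
have cvgC : rho ^+ n * C @[n --> \oo] --> (0 : R).
  rewrite -[X in _ --> X](mul0r C); apply: cvgMr_tmp.
  by apply: cvg_expr; rewrite ger0_norm.
have e3 : 0 < e / 3 by rewrite divr_gt0.
have /cvgrPdist_lt/(_ _ e3)[N _ NC] := cvgC.
have eD : 0 < e / 3 / (D + 1) by rewrite divr_gt0// ltr_wpDl.
have [n Nn pn] := clp _ eD N.
have h1 : `|p 0 j - u n 0 j| <= e / 3.
  apply: le_trans (ltW (pn j)) _.
  by rewrite ler_pdivrMr ?ltr_wpDl// ler_peMr ?lerDr// ltW.
have h2 : `|u n 0 j - u n.+1 0 j| <= e / 3.
  have := NC n Nn; rewrite /= sub0r normrN => /ltW; apply: le_trans.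
  apply: le_trans (le_trans (step n) (ler_norm _)).
  by have := coord_le_enorm (u n - u n.+1) j; rewrite !mxE.
have h3 : `|u n.+1 0 j - T p 0 j| <= e / 3.
  have := coord_le_enorm (u n.+1 - T p) j; rewrite !mxE => /le_trans; apply.
  apply: le_trans (lipT _ _ (Xu n) Xp) _.
  apply: le_trans (ler_piMl _ (ltW rho1)) _; first exact: sqrtr_ge0.
  have /le_trans : enorm (u n - p) <= D * (e / 3 / (D + 1)).
    apply: enorm_le; first exact: ltW.
    by move=> i; rewrite !mxE distrC ltW.
  apply; rewrite mulrCA ler_piMr ?(ltW e3)// ler_pdivrMr ?ltr_wpDl//.
  by rewrite mul1r lerDl.
have -> : T p 0 j - p 0 j = - ((p 0 j - u n 0 j) + (u n 0 j - u n.+1 0 j) +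
   (u n.+1 0 j - T p 0 j)).
  by ring.
rewrite normrN; apply: le_trans (ler_normD _ _) _.
apply: le_trans (lerD (ler_normD _ _) (lexx _)) _.
have -> : e = e / 3 + e / 3 + e / 3 by field.
by rewrite !lerD.
Qed.

(** * The limit set *)

(** The outermost map of a word is its first letter, whereas [word_comp] is
    defined by recursion on the innermost one. *)
Lemma word_comp_cons {R : realType} {d : nat} (T : nat -> 'rV[R]_d -> 'rV[R]_d)
    (i : nat) (w : nat -> nat) n x :
  word_comp T (fun k => if k is m.+1 then w m else i) n.+1 x =
  T i (word_comp T w n x).
Proof. by elim: n x => [//|n IH] x /=; rewrite -IH. Qed.

Section LimitSet.
Context {R : realType} {d : nat} (X : set 'rV[R]_d)
  (T : nat -> 'rV[R]_d -> 'rV[R]_d) (TX : forall i, T i @` X `<=` X).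

Lemma limit_set_sub : limit_set X T `<=` X.
Proof.
move=> x [w _ /(_ 1%N isT)[y Xy <-]] /=.
by apply: (TX (i := w 0%N)); exists y.
Qed.

Lemma limit_set_stable i x : limit_set X T x -> limit_set X T (T i x).
Proof.
move=> Fx; have Xx := limit_set_sub Fx; case: Fx => w _ wx.
exists (fun k => if k is m.+1 then w m else i) => // -[//|n] _.
have [y Xy yx] : (word_comp T w n @` X) x.
  by case: n => [|n]; [exists x|exact: wx].
by exists y => //; rewrite word_comp_cons yx.
Qed.

Lemma limit_set_fixed_point i p : X p -> T i p = p -> limit_set X T p.
Proof.
move=> Xp Tp; exists (fun=> i) => // n _; exists p => //.
by elim: n => //= n IH; rewrite Tp.
Qed.

End LimitSet.

(** A cluster point [c] of the images of one point serves for whole images,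
    because the contraction ratio of [S i] tends to [0] and [X] is bounded. *)
Lemma images_recur {R : realType} {d : nat} (X : set 'rV[R]_d)
    (S : nat -> 'rV[R]_d -> 'rV[R]_d) (rho M : R) :
  compact X -> X !=set0 -> (forall i, S i @` X `<=` X) -> 0 <= rho ->
  (forall i, lipschitz_with X (S i) rho) ->
  (forall x y, X x -> X y -> enorm (x - y) <= M) ->
  contraction_ratio X (S i) @[i --> \oo] --> (0 : R) ->
  exists c : 'rV[R]_d, forall e : R, 0 < e -> forall N, exists2 i, (N <= i)%N &
    forall x, X x -> forall j, `|c 0 j - S i x 0 j| < e.
Proof.
move=> cX [x0 Xx0] SX rho0 lipS diamX ratio0.
have M0 : 0 <= M by apply: le_trans (diamX _ _ Xx0 Xx0); exact: sqrtr_ge0.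
have XS i : X (S i x0) by apply: (SX i); exists x0.
have [c _ cS] := compact_sequence_recurs cX XS; exists c => e e0 N.
have e2 : 0 < e / 2 by rewrite divr_gt0.
pose r := e / 2 / (M + 1).
have r0 : 0 < r by rewrite divr_gt0// ltr_wpDl.
have /cvgrPdist_lt/(_ _ r0)[K _ Kr] := ratio0.
have [i Ni ci] := cS _ e2 (maxn N K).
exists i => [|x Xx j]; first exact: leq_trans (leq_maxl _ _) Ni.
have := Kr i (leq_trans (leq_maxr _ _) Ni).
rewrite /= sub0r normrN => /(le_lt_trans (ler_norm _)) /inf_lt.
case=> [|k [k0 lipk] kr]; first by exists rho; split => //; exact: lipS.
have -> : c 0 j - S i x 0 j = (c 0 j - S i x0 0 j) + (S i x0 0 j - S i x 0 j).
  by rewrite addrA subrK.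
apply: le_lt_trans (ler_normD _ _) _.
have -> : e = e / 2 + e / 2 by field.
apply: ltr_leD (ci j) _.
have := coord_le_enorm (S i x0 - S i x) j; rewrite !mxE => /le_trans; apply.
apply: le_trans (lipk _ _ Xx0 Xx) _.
apply: le_trans (ler_wpM2l k0 (diamX _ _ Xx0 Xx)) _.
apply: le_trans (ler_wpM2r M0 (ltW kr)) _.
by rewrite /r mulrAC ler_pdivrMr ?ltr_wpDl// ler_wpM2l ?lerDl// ltW.
Qed.

(** The boxes are open, which makes them Borel sets at once; together they miss
    only the walls of the grid, and approximation does not see the walls. *)
Definition grid_box {R : realType} {d n : nat} (k : {ffun 'I_d -> 'I_n.+1}) :
    set 'rV[R]_d :=
  [set x | forall j, (k j)%:R / n.+1%:R < x 0 j < (k j).+1%:R / n.+1%:R].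

(** The point [S i x0 + t i] of the limit set is within [2 / (n + 1)] of [y]:
    the part [S i x0] is close to [c], and [t i] is in the same grid box as
    [y - c]. *)
Lemma limit_set_dense {R : realType} {d : nat} (X : set 'rV[R]_d)
    (S : nat -> 'rV[R]_d -> 'rV[R]_d) (t : nat -> 'rV[R]_d) (c : 'rV[R]_d) :
  (forall i, translate S t i @` X `<=` X) ->
  limit_set X (translate S t) !=set0 ->
  (forall n (k : {ffun 'I_d -> 'I_n.+1}), exists2 i,
     forall x, X x -> forall j, `|c 0 j - S i x 0 j| < n.+1%:R^-1 &
     grid_box k (t i)) ->
  forall y : 'rV[R]_d, (forall j, c 0 j < y 0 j < c 0 j + 1) ->
    closure (limit_set X (translate S t)) y.
Proof.
move=> TX [x0 Fx0] hit y cy B /nbhs_rVP[e e0 eB].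
have [n en] : exists n, 2 / n.+1%:R < e.
  exists (Num.truncn (2 / e)).
  by rewrite ltr_pdivrMr// mulrC -ltr_pdivrMr// truncnS_gt.
have y0 j : 0 <= (y 0 j - c 0 j) * n.+1%:R.
  by have /andP[cy1 _] := cy j; rewrite mulr_ge0// subr_ge0 ltW.
pose k := [ffun j => inord (Num.truncn ((y 0 j - c 0 j) * n.+1%:R)) : 'I_n.+1].
have kE j : (k j)%:R / n.+1%:R <= y 0 j - c 0 j < (k j).+1%:R / n.+1%:R.
  rewrite ffunE inordK; last first.
    rewrite truncn_lt_nat// gtr_pMl// ltrBlDl.
    by have /andP[] := cy j.
  by rewrite ler_pdivrMr// ltr_pdivlMr// truncn_itv.
have [i ci ki] := hit n k.
exists (S i x0 + t i); split; first exact: (limit_set_stable TX).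
apply: eB => j; apply: le_lt_trans en.
have {ci} := ci _ (limit_set_sub TX Fx0) j.
have := kE j; have := ki j; rewrite !mxE -[(k j).+1%:R]natr1.
rewrite (mulrDl _ 1 n.+1%:R^-1) mul1r.
set a := _ / _; set b := n.+1%:R^-1; set s := S i x0 0 j; set z := t i 0 j.
rewrite ltr_norml ler_norml => /andP[h1 h2] /andP[h3 h4] /andP[h5 h6].
by apply/andP; split; rewrite -/b; lra.
Qed.

(** * Lebesgue measure of boxes *)

Lemma lebesgue_rV_set0 {R : realType} (d : nat) :
  lebesgue_rV (set0 : set 'rV[R]_d) = 0%E.
Proof.
elim: d => [|d IH] /=; first by rewrite indic0.
by rewrite -[RHS](integral0 lebesgue_measure setT); apply: eq_integral.
Qed.

(** Cavalieri: the section of the box at [x] is empty unless [x] is in the first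
    side, and is then the box of the other sides. *)
Lemma lebesgue_rV_open_box {R : realType} (d : nat) (a b : 'I_d -> R) :
  (forall j, a j <= b j) ->
  lebesgue_rV [set x : 'rV[R]_d | forall j, a j < x 0 j < b j] =
  (\prod_j (b j - a j))%:E.
Proof.
elim: d a b => [|d IH] a b ab /=.
  by rewrite big_ord0 indicE mem_set// => -[].
pose p := \prod_j (b (lift ord0 j) - a (lift ord0 j)).
have p0 : 0 <= p by apply: prodr_ge0 => j _; rewrite subr_ge0.
have rowS (x : R) (v : 'rV[R]_d) (j : 'I_d) :
    row_mx (x%:M : 'rV_1) v 0 (lift ord0 j) = v 0 j.
  by rewrite mxE split1 liftK.
have row0 (x : R) (v : 'rV[R]_d) : row_mx (x%:M : 'rV_1) v 0 ord0 = x.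
  by rewrite mxE split1 unlift_none /= mxE eqxx.
transitivity (\int[@lebesgue_measure R]_x
    (p%:E * (\1_(`]a ord0, b ord0[%classic : set R) x)%:E))%E.
  apply: eq_integral => x _.
  have [xab|xab] := boolP (a ord0 < x < b ord0).
    rewrite indicE mem_set ?in_itv//= mule1 -IH//; congr lebesgue_rV.
    apply/seteqP; split => v /= abv j.
      by have := abv (lift ord0 j); rewrite rowS.
    by have [k ->|->] := unliftP ord0 j; rewrite ?rowS ?row0.
  rewrite indicE memNset/= ?in_itv//=; last exact/negP.
  rewrite mule0 -(lebesgue_rV_set0 d); congr lebesgue_rV.
  apply/seteqP; split => v //= /(_ ord0).
  by rewrite row0 (negbTE xab).
rewrite ge0_integralZl_EFin//=; last exact/measurable_EFinP.
rewrite integral_indic// setIT big_ord_recl -/p mulrC EFinM; congr (_ * _)%E.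
apply: etrans (lebesgue_measure_itv _) _; rewrite /= lte_fin.
have := ab ord0; rewrite le_eqVlt => /orP[/eqP->|->//].
by rewrite ltxx subrr.
Qed.

Lemma borel_open {R : realType} {d : nat} (A : set 'rV[R]_d) :
  open A -> borel_rV A.
Proof. exact: sub_sigma_algebra. Qed.

Lemma borel_setC {R : realType} {d : nat} (A : set 'rV[R]_d) :
  borel_rV A -> borel_rV (~` A).
Proof.
by move=> bA; rewrite -setTD; apply: sigma_algebraCD; exact: bA.
Qed.

Lemma open_grid_box {R : realType} {d n : nat} (k : {ffun 'I_d -> 'I_n.+1}) :
  open (@grid_box R d n k).
Proof.
rewrite openE => x kx.
apply: (@filter_forall _ _ (fun j => [set y : 'rV[R]_d |
  (k j)%:R / n.+1%:R < y 0 j < (k j).+1%:R / n.+1%:R]) (nbhs x) _) => j.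
have /near_in_itvoo : x 0 j \in `](k j)%:R / n.+1%:R, (k j).+1%:R / n.+1%:R[.
  by rewrite in_itv/=; exact: kx.
move=> /(@coord_continuous R 1 d 0 j x); rewrite nbhs_filterE.
by apply: (@filterS _ (nbhs x)) => y /=; rewrite in_itv.
Qed.

Lemma lebesgue_grid_box {R : realType} {d n : nat}
    (k : {ffun 'I_d -> 'I_n.+1}) :
  lebesgue_unit_cube (@grid_box R d n k) = (n.+1%:R^-1 ^+ d)%:E.
Proof.
rewrite /lebesgue_unit_cube (_ : _ `&` _ = grid_box k); last first.
  apply/setIidPl => x kx j; have /andP[kx1 kx2] := kx j.
  rewrite (le_trans _ (ltW kx1)) ?divr_ge0//= (lt_le_trans kx2)//.
  by rewrite ler_pdivrMr// mul1r ler_nat.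
rewrite lebesgue_rV_open_box; last by move=> j; rewrite ler_pM2r ?ler_nat.
congr EFin; rewrite -[X in _ ^+ X](card_ord d) -prodr_const.
by apply: eq_bigr => j _; rewrite -mulrBl -natr1 addrAC subrr add0r mul1r.
Qed.

(** * Random translations *)

(** Filter laws in which the measure is an explicit argument, so that unification
    and not instance search supplies the structure of the sequence space. *)
Lemma ae_imply {dT : measure_display} {T : measurableType dT} {R : realType}
    (mu : {measure set T -> \bar R}) (P Q : T -> Prop) :
  (forall t, P t -> Q t) ->
  {ae mu, forall t, P t} -> {ae mu, forall t, Q t}.
Proof. by move=> PQ; apply: filterS. Qed.

Lemma ae_imply2 {dT : measure_display} {T : measurableType dT} {R : realType}
    (mu : {measure set T -> \bar R}) (P1 P2 Q : T -> Prop) :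
  (forall t, P1 t -> P2 t -> Q t) ->
  {ae mu, forall t, P1 t} -> {ae mu, forall t, P2 t} -> {ae mu, forall t, Q t}.
Proof. by move=> PQ; apply: filterS2. Qed.

Lemma ae_countable {dT : measure_display} {T : measurableType dT} {R : realType}
    (mu : {measure set T -> \bar R}) (I : countType) (Q : I -> T -> Prop) :
  (forall k, {ae mu, forall t, Q k t}) -> {ae mu, forall t, forall k, Q k t}.
Proof.
move=> aeQ.
have : {ae mu, forall t, forall n,
    if unpickle n is Some k then Q k t else True}.
  apply: ae_foralln => n; case: (unpickle n) => [k|]; first exact: aeQ.
  exact: aeW.
by apply: filterS => t Qt k; have := Qt (pickle k); rewrite pickleK.
Qed.

Section InfiniteProduct.
Context {R : realType} {d : nat} (P : set 'rV[R]_d -> \bar R)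
  (mu : probability (@seq_rV R d) R) (hmu : is_infinite_product P mu).

Lemma measurable_coord (i : nat) (A : set 'rV[R]_d) :
  borel_rV A -> measurable ([set t | A (t i)] : set (@seq_rV R d)).
Proof. by move=> bA; apply: sub_sigma_algebra; exists i, A. Qed.

Let borelT : borel_rV ([set: 'rV[R]_d]).
Proof. exact: (borel_open openT). Qed.

(** The values of the set function [P] on Borel sets are probabilities because
    [P] is a marginal of [mu]. *)
Lemma product_marginalT : P setT = 1%E.
Proof.
have := hmu 1 (fun=> borelT); rewrite big_ord_recl big_ord0 mule1 => <-.
by rewrite -[RHS](@probability_setT _ _ _ mu); congr (mu _); apply/seteqP.
Qed.

Lemma product_marginal i A : borel_rV A -> mu [set t | A (t i)] = P A.
Proof.
move=> bA; pose B j := if j == i then A else setT.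
have bB j : borel_rV (B j) by rewrite /B; case: ifP.
have Bi : B i = A by rewrite /B eqxx.
have := hmu i.+1 bB; rewrite big_ord_recr/= Bi big1 ?mul1e => [<-|j _].
  congr (mu _); apply/seteqP; split => t /=; last first.
    by move/(_ i (leqnn _)); rewrite Bi.
  by move=> At j _; rewrite /B; case: eqP => // ->.
by rewrite /B ifN ?product_marginalT// neq_ltn ltn_ord.
Qed.

Lemma product_marginalC A : borel_rV A -> P (~` A) = (1 - P A)%E.
Proof.
move=> bA; rewrite -(product_marginal 0 (borel_setC bA)).
rewrite -(product_marginal 0 bA).
by rewrite -probability_setC//; exact: measurable_coord.
Qed.

(** The event that [t i] stays in [A i] for all [i] has, for every [k], a
    probability at most [q ^ k]: keep [k] of the infinitely many factors that
    are at most [q], and bound the others by [1]. *)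
Lemma ae_infinite_product_escape (A : nat -> set 'rV[R]_d) (q : R) :
  (forall i, borel_rV (A i)) -> q < 1 ->
  (forall N, exists2 i, (N <= i)%N & (P (A i) <= q%:E)%E) ->
  {ae mu, forall t : nat -> 'rV[R]_d, exists i, ~ A i (t i)}.
Proof.
move=> bA q1 Aq; pose p i := fine (P (A i)).
have p01 i : 0 <= p i <= 1.
  rewrite /p -(product_marginal 0 (bA i)) -!lee_fin fineK ?fin_num_measure//;
    [|exact: measurable_coord..].
  by rewrite measure_ge0 probability_le1//; exact: measurable_coord.
have PE i : P (A i) = (p i)%:E.
  rewrite /p fineK// -(product_marginal 0 (bA i)) fin_num_measure//.
  exact: measurable_coord.
have prodE n : (\prod_(i < n) P (A i))%E = (\prod_(i < n) p i)%:E.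
  elim: n => [|n IH]; first by rewrite !big_ord0.
  by rewrite !big_ord_recr /= IH PE EFinM.
have q0 : 0 <= q.
  have [i _] := Aq 0%N; rewrite PE lee_fin; apply: le_trans.
  by have /andP[] := p01 i.
have decr n m : \prod_(i < n + m) p i <= \prod_(i < n) p i.
  elim: m => [|m IH]; first by rewrite addn0.
  rewrite addnS big_ord_recr/= (le_trans _ IH)// ler_piMr//.
    by apply: prodr_ge0 => i _; have /andP[] := p01 i.
  by have /andP[] := p01 (n + m)%N.
have small k : exists n, \prod_(i < n) p i <= q ^+ k.
  elim: k => [|k [n IH]]; first by exists 0%N; rewrite big_ord0.
  have [i ni] := Aq n; rewrite PE lee_fin => piq.
  exists i.+1; rewrite big_ord_recr exprSr /= ler_pM//.
  - by apply: prodr_ge0 => j _; have /andP[] := p01 j.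
  - by have /andP[] := p01 i.
  - by have := decr n (i - n)%N; rewrite subnKC// => /le_trans; apply.
pose N : set (@seq_rV R d) := [set t | forall i, A i (t i)].
have mN : measurable N.
  rewrite (_ : N = \bigcap_i [set t | A i (t i)]).
    by apply: bigcapT_measurable => i; exact: measurable_coord.
  by apply/seteqP; split => [t At i _|t At i]; [exact: At|exact: (At i I)].
have muN k : (mu N <= (q ^+ k)%:E)%E.
  have [n nk] := small k.
  rewrite (@le_trans _ _ (\prod_(i < n) P (A i))%E)//; last first.
    by rewrite prodE lee_fin.
  rewrite -(hmu n bA); apply: le_measure; rewrite ?inE//.
    rewrite (_ : mkset _ =
        \bigcap_(i in [set i | (i < n)%N]) [set t | A i (t i)]).
      apply: fin_bigcap_measurable => [|i _]; first exact: finite_II.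
      exact: measurable_coord.
    by apply/seteqP; split => t At i ni; exact: (At i ni).
  by move=> t At i _; exact: At.
exists N; split=> //; last by move=> t /= /forallNP At i; exact: contrapT.
apply/eqP; rewrite eq_le measure_ge0 andbT.
apply/lee_addgt0Pr => e e0; rewrite add0e.
have /cvgrPdist_lt/(_ _ e0)[k _ /(_ k (leqnn k))] :
    q ^+ k @[k --> \oo] --> (0 : R).
  by apply: cvg_expr; rewrite ger0_norm.
rewrite /= sub0r normrN => /(le_lt_trans (ler_norm _))/ltW qk.
by rewrite (le_trans (muN k))// lee_fin.
Qed.

End InfiniteProduct.

Lemma ae_translations_hit {R : realType} {d : nat}
    (mu : probability (@seq_rV R d) R) (n : nat) (k : {ffun 'I_d -> 'I_n.+1})
    (I : set nat) :
  is_infinite_product (@lebesgue_unit_cube R d) mu ->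
  (forall N, exists2 i, (N <= i)%N & I i) ->
  {ae mu, forall t : nat -> 'rV[R]_d, exists2 i, I i & grid_box k (t i)}.
Proof.
move=> hmu infI; pose q : R := 1 - n.+1%:R^-1 ^+ d.
pose A i : set 'rV[R]_d := if i \in I then ~` grid_box k else setT.
have bA i : borel_rV (A i).
  rewrite /A; case: ifP => _; last exact: (borel_open openT).
  by apply: borel_setC; apply: borel_open; apply: open_grid_box.
have q1 : q < 1 by rewrite /q gtrBl exprn_gt0// invr_gt0.
have Aq N : exists2 i, (N <= i)%N & (lebesgue_unit_cube (A i) <= q%:E)%E.
  have [i Ni Ii] := infI N; exists i => //; rewrite /A mem_set//.
  rewrite (product_marginalC hmu) ?lebesgue_grid_box//.
  by apply: borel_open; apply: open_grid_box.
apply: ae_imply (ae_infinite_product_escape hmu bA q1 Aq) => t [i].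
rewrite /A; case: ifPn => [/set_mem Ii /contrapT ti|_ []//].
by exists i.
Qed.

Lemma ae_translations_in_cube {R : realType} {d : nat}
    (mu : probability (@seq_rV R d) R) :
  is_infinite_product (@lebesgue_unit_cube R d) mu ->
  {ae mu, forall t : nat -> 'rV[R]_d, forall i, half_open_cube 0 1 (t i)}.
Proof.
move=> hmu; apply: ae_foralln => i.
(* The open unit cube is the only box of the coarsest grid, and it already has
   full measure. *)
pose U : set 'rV[R]_d := grid_box [ffun=> ord0 : 'I_1].
have bU : borel_rV U by by apply: borel_open; apply: open_grid_box.
have : {ae mu, forall t : nat -> 'rV[R]_d, U (t i)}.
  exists [set t | (~` U) (t i)]; split => //.
    by apply: measurable_coord; exact: borel_setC.
  rewrite (product_marginal hmu) ?(product_marginalC hmu)//; last first.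
    exact: borel_setC.
  by rewrite lebesgue_grid_box invr1 expr1n subee.
apply: ae_imply => t Ut j; have := Ut j.
by rewrite ffunE /= mul0r invr1 mulr1 => /andP[/ltW-> ->].
Qed.

(** * Counting inequalities for covers *)

Lemma enorm_const {R : realType} {d : nat} (x : 'rV[R]_d) (r : R) :
  0 <= r -> (forall j, x 0 j = r) -> enorm x = Num.sqrt d%:R * r.
Proof.
move=> r0 xr; rewrite -[in RHS](ger0_norm r0) -sqrtr_sqr -sqrtrM ?ler0n//.
congr Num.sqrt; under eq_bigr do rewrite xr.
by rewrite sumr_const card_ord mulr_natl.
Qed.

Lemma diam_coord_le {R : realType} {d : nat} (U : set 'rV[R]_d) (r : R) x y j :
  (diam U <= r%:E)%E -> U x -> U y -> `|x 0 j - y 0 j| <= r.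
Proof.
move=> Ur Ux Uy; have := coord_le_enorm (x - y) j; rewrite !mxE => /le_trans.
apply; rewrite -lee_fin (le_trans _ Ur)//.
by apply: ereal_sup_ubound; exists x => //; exists y.
Qed.

(** Lebesgue measure is replaced by counting points.  The grid points
    [p + h k / N] lie in the closure of [F]; perturbing each one slightly gives
    [N ^ d] points of [F].  For [N] large, two of them in the same [U i] have
    indices that differ by less than about [N l_i / h] in each coordinate, so
    [U i] contains at most [(3 N l_i / h) ^ d] of them. *)
Lemma dense_cover_volume {R : realType} {d : nat} (F : set 'rV[R]_d)
    (p : 'rV[R]_d) (h : R) (T : finType) (U : T -> set 'rV[R]_d) (l : T -> R) :
  0 < h ->
  (forall y : 'rV[R]_d, (forall j, `|p 0 j - y 0 j| < h) -> closure F y) ->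
  F `<=` \bigcup_(i in [set: T]) U i ->
  (forall i, 0 < l i) -> (forall i, (diam (U i) <= (l i)%:E)%E) ->
  h ^+ d <= \sum_i (3 * l i) ^+ d.
Proof.
move=> h0 Fdense FU l0 Ul.
pose N := (\max_i (Num.truncn (h / l i)).+1).+1.
(* N is so large that no l i is smaller than the mesh h / N, which lets the
   constant 3 absorb rounding. *)
have Nl i : 1 <= N%:R * l i / h.
  rewrite ler_pdivlMr// mul1r -ler_pdivrMr//.
  apply: le_trans (ltW (truncnS_gt _)) _; rewrite ler_nat.
  apply: leqW; exact: (leq_bigmax (F := fun i => (Num.truncn (h / l i)).+1)).
have N0 : 0 < N%:R :> R by rewrite ltr0n.
pose y (k : {ffun 'I_d -> 'I_N}) : 'rV[R]_d :=
  \row_j (p 0 j + h * (k j)%:R / N%:R).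
have Fy k : closure F (y k).
  apply: Fdense => j; rewrite mxE opprD addrA subrr add0r normrN ger0_norm.
    by rewrite ltr_pdivrMr// ltr_pM2l// ltr_nat.
  by rewrite divr_ge0// mulr_ge0// ltW.
have e0 : 0 < h / (4 * N%:R) by rewrite divr_gt0// mulr_gt0.
have /choice[g gP] k : exists i, exists2 f, U i f &
    forall j, `|y k 0 j - f 0 j| < h / (4 * N%:R).
  have [f [Ff yf]] :
      F `&` [set z | forall j, `|y k 0 j - z 0 j| < h / (4 * N%:R)] !=set0.
    by apply: (Fy k); apply/nbhs_rVP; exists (h / (4 * N%:R)).
  by have [i _ Uif] := FU _ Ff; exists i, f.
(* The radius h / (4 N) of the perturbation adds 1/2 to the index difference. *)
pose m i := (Num.truncn (N%:R * l i / h)).+2.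
have mE i : N%:R * l i / h + 2^-1 < (m i)%:R.
  rewrite /m; move: (N%:R * l i / h) => x.
  by rewrite -[(Num.truncn x).+2%:R]natr1; have := truncnS_gt x; lra.
have close k k' j : g k = g k' -> (k j < k' j + m (g k))%N.
  move=> gk; have [f Uf yf] := gP k; have [f' Uf' yf'] := gP k'.
  rewrite -gk in Uf'.
  have ff := diam_coord_le j (Ul _) Uf Uf'.
  move: (yf j) (yf' j) ff; rewrite !mxE !ltr_norml ler_norml.
  move=> /andP[a1 a2] /andP[b1 b2] /andP[c1 c2].
  rewrite -(ltr_nat R) natrD -ltrBlDl; apply: le_lt_trans (mE (g k)).
  rewrite -(ler_pM2l h0) -(ler_pM2r (_ : 0 < N%:R^-1)) ?invr_gt0//.
  have -> : h * (N%:R * l (g k) / h + 2^-1) / N%:R =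
      l (g k) + 2 * (h / (4 * N%:R)).
    by field; rewrite !gt_eqF.
  rewrite mulrBr mulrBl; lra.
have fiber i : (#|[pred k | g k == i]| <= m i ^ d)%N.
  (* Reduction modulo m i is injective on indices that differ by less than m i
     in each coordinate. *)
  pose r (k : {ffun 'I_d -> 'I_N}) : {ffun 'I_d -> 'I_(m i)} :=
    [ffun j => inord (k j %% m i)].
  rewrite -[X in (_ ^ X)%N](card_ord d) -[X in (X ^ _)%N](card_ord (m i)).
  rewrite -card_ffun.
  rewrite -(@card_in_imset _ _ r) ?max_card// => k k'.
  rewrite !inE => /eqP gk /eqP gk' /ffunP rk; apply/ffunP => j; apply: val_inj.
  have := congr1 val (rk j); rewrite !ffunE /= !inordK ?ltn_pmod// => kk'.
  have := close k k' j; have := close k' k j; rewrite gk gk'.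
  move=> /(_ erefl) c1 /(_ erefl) c2; move: kk'.
  rewrite /= (divn_eq (k j) (m i)) (divn_eq (k' j) (m i)) in c1 c2 * => kk'.
  rewrite !modnMDl !modn_mod in kk'; rewrite kk' in c1 c2 *.
  rewrite addnAC ltn_add2r -mulSnr ltn_pmul2r// ltnS in c1.
  rewrite addnAC ltn_add2r -mulSnr ltn_pmul2r// ltnS in c2.
  by congr (_ * _ + _)%N; apply/eqP; rewrite eqn_leq c1 c2.
have card_le : (N ^ d <= \sum_i m i ^ d)%N.
  rewrite -[X in (_ ^ X)%N](card_ord d) -[X in (X ^ _)%N](card_ord N).
  rewrite -card_ffun.
  rewrite -sum1_card (partition_big g xpredT)//=; apply: leq_sum => i _.
  by apply: leq_trans (fiber i); rewrite -sum1_card.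
have : (N ^ d)%:R <= \sum_i (3 * (N%:R * l i / h)) ^+ d.
  apply: le_trans (_ : (\sum_i m i ^ d)%:R <= _); first by rewrite ler_nat.
  rewrite natr_sum; apply: ler_sum => i _; rewrite natrX lerXn2r ?nnegrE//.
    by rewrite !mulr_ge0// ?invr_ge0// ltW.
  rewrite /m; have := Nl i; move: (N%:R * l i / h) => x x1.
  rewrite -[(Num.truncn x).+2%:R]natr1 -[(Num.truncn x).+1%:R]natr1.
  have : (Num.truncn x)%:R <= x by rewrite truncn_le (le_trans _ x1).
  lra.
rewrite natrX -(ler_pM2l (_ : 0 < (h / N%:R) ^+ d)); last first.
  by rewrite exprn_gt0// divr_gt0.
rewrite -exprMn divfK ?gt_eqF// => /le_trans; apply.
rewrite mulr_sumr ler_sum// => i _; rewrite -exprMn.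
by rewrite (_ : _ * (3 * _) = 3 * l i)//; field; rewrite !gt_eqF.
Qed.

Section GridCover.
Context {R : realType} {d : nat}.

(** With [d] the dimension and [delta <= 1], a grid on [[0,2]] of mesh
    [delta / sqrt d] has at most [2 sqrt d / delta + 1] intervals, hence at most
    [grid_const / delta]. *)
Definition grid_const : R := 2 * Num.sqrt d%:R + 1.

Lemma grid_const_gt0 : 0 < grid_const.
Proof. by rewrite ltr_wpDl// mulr_ge0// sqrtr_ge0. Qed.

Lemma cube_grid_cover (delta : R) : (0 < d)%N -> 0 < delta <= 1 ->
  exists (N : nat) (U : nat -> set 'rV[R]_d),
    [/\ N%:R <= (grid_const / delta) ^+ d,
      closed_cube 0 2 `<=` \bigcup_(i in `I_N) U i &
      forall i, diam (U i) = delta%:E].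
Proof.
move=> d0 /andP[delta0 delta1].
(* A cube of side h has diameter delta. *)
pose h := delta / Num.sqrt d%:R.
have sd0 : 0 < Num.sqrt (d%:R : R) by rewrite sqrtr_gt0 ltr0n.
have h0 : 0 < h by rewrite divr_gt0.
pose M := (Num.truncn (2 / h)).+1.
pose K : finType := {ffun 'I_d -> 'I_M}.
pose Q (k : K) := [set x : 'rV[R]_d |
  forall j, (k j)%:R * h <= x 0 j <= (k j).+1%:R * h].
pose k0 : K := [ffun=> ord0].
exists #|K|, (fun i => Q (nth k0 (enum K) i)); split.
- rewrite card_ffun !card_ord natrX lerXn2r ?nnegrE//.
    by rewrite divr_ge0// ltW// grid_const_gt0.
  rewrite /M -[(Num.truncn _).+1%:R]natr1 [leRHS]mulrDl mul1r lerD//.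
    apply: (le_trans (_ : _ <= 2 / h)).
      by rewrite truncn_le divr_ge0// ltW.
    by rewrite /h invf_div mulrA.
  by rewrite invf_ge1.
- move=> x x02; have xh0 j : 0 <= x 0 j / h.
    by rewrite divr_ge0 ?(ltW h0)//; have /andP[] := x02 j.
  pose k : K := [ffun j => inord (Num.truncn (x 0 j / h))].
  exists (index k (enum K)) => /=.
    by rewrite cardE index_mem mem_enum.
  rewrite nth_index ?mem_enum// => j; rewrite ffunE inordK.
    have /andP[a /ltW b] := truncn_itv (xh0 j).
    by rewrite -ler_pdivlMr// a -ler_pdivrMr.
  rewrite ltnS le_truncn// ler_pM2r ?invr_gt0//.
  by have /andP[] := x02 j.
move=> i; move: (nth _ _ _) => k; apply/eqP; rewrite eq_le; apply/andP; split.
  apply/ereal_supP => _ [x kx [y ky <-]]; rewrite lee_fin.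
  rewrite [leRHS](_ : _ = Num.sqrt d%:R * h); last first.
    by rewrite /h mulrC divfK// gt_eqF.
  apply: enorm_le => [|j]; first exact: ltW.
  rewrite !mxE ler_norml; have := kx j; have := ky j.
  rewrite -natr1 mulrDl mul1r.
  move=> /andP[? ?] /andP[? ?]; lra.
pose x : 'rV[R]_d := \row_j ((k j).+1%:R * h).
pose y : 'rV[R]_d := \row_j ((k j)%:R * h).
apply: ereal_sup_ubound; exists x.
  by move=> j; rewrite mxE lexx ler_pM2r// ler_nat leqnSn.
exists y; first by move=> j; rewrite mxE lexx ler_pM2r// ler_nat leqnSn.
congr EFin; rewrite (@enorm_const _ _ _ h) ?ltW//.
  by rewrite /h mulrC divfK// gt_eqF.
by move=> j; rewrite !mxE -natr1 mulrDl mul1r addrAC subrr add0r.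
Qed.

End GridCover.
Arguments grid_const : clear implicits.

(** * Dimensions of somewhere dense subsets of the cube *)

Lemma somewhere_dense_ball {R : realType} {d : nat} (F : set 'rV[R]_d) :
  somewhere_dense F -> exists (p : 'rV[R]_d) (h : R), 0 < h /\
    forall y : 'rV[R]_d, (forall j, `|p 0 j - y 0 j| < h) -> closure F y.
Proof. by move=> [p /nbhs_rVP[h h0 hF]]; exists p, h. Qed.

(** Properness of [F] is what forces the upper limit above the lower one: any
    two members of [F] meet. *)
Lemma limf_squeeze {R : realType} {T : topologicalType} (f : T -> \bar R)
    (F : set_system T) (v : R) : ProperFilter F ->
  (forall e : R, 0 < e ->
    F [set x | ((v - e)%:E <= f x <= (v + e)%:E)%E]) ->
  limf_esup f F = v%:E /\ limf_einf f F = v%:E.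
Proof.
move=> FF Fv; rewrite limf_esupE limf_einfE.
pose V e := [set x | ((v - e)%:E <= f x <= (v + e)%:E)%E].
split; apply/eqP; rewrite eq_le; apply/andP; split; apply/lee_addgt0Pr => e e0.
- apply: ge_ereal_inf; exists (ereal_sup [set f x | x in V e]).
    by exists (V e) => //; exact: Fv.
  by apply/ereal_supP => _ [x /andP[_ fx] <-].
- rewrite -leeBlDr// -EFinB; apply/ereal_infP => _ [W FW <-].
  have [x [/andP[vf _] Wx]] := filter_ex (filterI (Fv e e0) FW).
  by apply: le_trans vf _; apply: ereal_sup_ubound; exists x.
- apply/ereal_supP => _ [W FW <-].
  have [x [/andP[_ fv] Wx]] := filter_ex (filterI (Fv e e0) FW).
  by apply: (le_trans _ fv); apply: ereal_inf_lbound; exists x.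
- rewrite -leeBlDr// -EFinB; apply: le_ereal_sup_tmp.
  exists (ereal_inf [set f x | x in V e]).
    by exists (V e) => //; exact: Fv.
  by apply/ereal_infP => _ [x /andP[vf _] <-].
Qed.

Section DimensionValues.
Context {R : realType} {d : nat} (d0 : (0 < d)%N) (F : set 'rV[R]_d).

Lemma lower_le_upper_intermediate_dim (theta : R) :
  (lower_intermediate_dim theta F <= upper_intermediate_dim theta F)%E.
Proof.
apply: ereal_inf_le_tmp => _ [s [s0 sup] <-]; exists s => //; split => //.
move=> eps delta0 eps0 /andP[delta00 delta01].
have [delta1 [/andP[delta10 _] cov]] := sup _ eps0.
have m0 : 0 < Num.min delta0 delta1 by rewrite lt_min delta00.
exists (Num.min delta0 delta1 / 2); split.
  rewrite divr_gt0//= ltr_pdivrMr// (@le_lt_trans _ _ delta0) ?ge_min ?lexx//.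
  by rewrite ltr_pMr// ltr1n.
apply: cov; rewrite divr_gt0//= ltr_pdivrMr//.
rewrite (@le_lt_trans _ _ delta1) ?ge_min ?lexx ?orbT//.
by rewrite ltr_pMr// ltr1n.
Qed.

(** The grid cover by cubes of diameter [delta] has [s]-sum at most a constant
    times [delta ^ (s - d)], which tends to [0] for [s = d + eta]. *)
Lemma upper_intermediate_dim_le (theta : R) : 0 < theta <= 1 ->
  F `<=` closed_cube 0 2 -> (upper_intermediate_dim theta F <= d%:R%:E)%E.
Proof.
move=> /andP[theta0 theta1] F2; apply/lee_addgt0Pr => eta eta0.
apply: ereal_inf_lbound; exists (d%:R + eta) => //; split.
  by rewrite addr_ge0// ltW.
move=> eps eps0; pose G := grid_const R d ^+ d.
have G0 : 0 < G by rewrite exprn_gt0// grid_const_gt0.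
pose delta1 := (eps / G) `^ eta^-1.
have delta10 : 0 < delta1 by rewrite powR_gt0// divr_gt0.
exists (Num.min 1 delta1); split.
  by rewrite lt_min ltr01 delta10 ge_min lexx.
move=> delta; rewrite lt_min => /and3P[delta0 dlt1 dltd].
have d01 : 0 < delta <= 1 by rewrite delta0 ltW.
have [N [U [NG FU diamU]]] := cube_grid_cover d0 d01.
exists `I_N, U; split; first exact: subset_trans F2 FU.
  move=> i _; rewrite diamU lexx andbT lee_fin ge1r_powR//.
  by rewrite invf_ge1.
rewrite esum_fset//; last by move=> i _; exact: poweR_ge0.
rewrite -fsbig_ord (eq_bigr (fun=> (delta `^ (d%:R + eta))%:E)); last first.
  by move=> i _; rewrite diamU poweR_EFin.
rewrite sumEFin lee_fin sumr_const card_ord -[_ *+ N]mulr_natl powRD; last first.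
  by rewrite (gt_eqF delta0) implybT.
rewrite powR_mulrn ?(ltW delta0)// mulrA.
have NG' : N%:R * delta ^+ d <= G.
  by rewrite -ler_pdivlMr ?exprn_gt0// -expr_div_n.
apply: le_trans (ler_wpM2r (powR_ge0 delta eta) NG') _.
rewrite -ler_pdivlMl// mulrC.
have -> : eps / G = delta1 `^ eta.
  by rewrite -powRrM mulVf ?gt_eqF// powRr1// ltW// divr_gt0.
by apply: ge0_ler_powR; rewrite ?nnegrE ltW.
Qed.

(** For [s < d] and [delta < 1], diameters [l] of an admissible cover satisfy
    [l ^ d <= l ^ s], so the volume inequality bounds the [s]-sum below by a
    constant.  It concerns finite covers: the lower bound
    [delta ^ (1 / theta)] on the diameters makes a cover with finite [s]-sum
    finite. *)
Lemma lower_intermediate_dim_ge (theta : R) : 0 < theta <= 1 ->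
  somewhere_dense F -> (d%:R%:E <= lower_intermediate_dim theta F)%E.
Proof.
move=> /andP[theta0 theta1] /somewhere_dense_ball[p [h [h0 Fh]]].
apply/ereal_infP => _ [s [s0 cov] <-]; rewrite lee_fin leNgt; apply/negP => sd.
(* The volume inequality gives an s-sum of at least (h / 3) ^ d. *)
pose eps := (h / 3) ^+ d / 2.
have h3 : 0 < (h / 3) ^+ d by rewrite exprn_gt0// divr_gt0.
have eps0 : 0 < eps by rewrite divr_gt0.
have one : 0 < (1 : R) <= 1 by rewrite ltr01 lexx.
have [delta [/andP[delta0 delta1] [I [U [FU diamU sumU]]]]] := cov _ _ eps0 one.
pose a := delta `^ theta^-1.
have a0 : 0 < a by exact: powR_gt0.
pose l i := fine (diam (U i)).
have lE i : I i -> diam (U i) = (l i)%:E /\ a <= l i <= delta.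
  move=> /diamU /andP[]; rewrite /l; case: (diam (U i)) => [r| |]//=.
  by rewrite !lee_fin => -> ->.
have sum_fset (X : {fset nat}) : [set` X] `<=` I ->
    \sum_(i <- X) l i `^ s <= eps.
  move=> XI; rewrite -lee_fin -sumEFin (le_trans _ sumU)//.
  apply: esum_ge; exists [set` X]; first by split => //; exact: finite_fset.
  rewrite -fsbig_seq ?fset_uniq//= big_seq [leRHS]big_seq.
  by apply: lee_sum => i iX; have [-> _] := lE i (XI i iX); rewrite poweR_EFin.
have finI : finite_set I.
  apply: contrapT => /infinite_set_fset.
  move=> /(_ (Num.truncn (eps / a `^ s)).+1)[X XI Xn].
  have := sum_fset X XI; apply/negP; rewrite -ltNge.
  apply: (@lt_le_trans _ _ (\sum_(i <- X) a `^ s)).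
    rewrite big_const_seq count_predT iter_addr_0 -mulr_natl.
    rewrite -ltr_pdivrMr ?powR_gt0//.
    by apply: lt_le_trans (truncnS_gt _) _; rewrite ler_nat.
  rewrite big_seq [leRHS]big_seq; apply: ler_sum => i iX.
  have [_ /andP[al _]] := lE i (XI i iX).
  by apply: ge0_ler_powR => //; rewrite nnegrE ltW// (lt_le_trans a0).
have [X XE] := finite_fsetP.1 finI.
have Xl (i : X) : diam (U (val i)) = (l (val i))%:E /\ a <= l (val i) <= delta.
  by apply: lE; rewrite XE /=; exact: valP.
have : h ^+ d <= \sum_(i : X) (3 * l (val i)) ^+ d.
  apply: (dense_cover_volume h0 Fh (U := fun i : X => U (val i))).
  - move=> x /FU[i]; rewrite XE /= => iX Uix.
    by exists [` iX]%fset.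
  - by move=> i; have [_ /andP[al _]] := Xl i; exact: lt_le_trans al.
  - by move=> i; have [-> _] := Xl i.
under eq_bigr do rewrite exprMn.
rewrite -mulr_sumr -ler_pdivrMl ?exprn_gt0// mulrC -expr_div_n.
apply/negP; rewrite -ltNge.
apply: (@le_lt_trans _ _ eps); last first.
  by rewrite /eps ltr_pdivrMr// ltr_pMr// ltr1n.
apply: (@le_trans _ _ (\sum_(i <- X) l i `^ s)); last first.
  by apply: sum_fset; rewrite XE.
rewrite big_seq_fsetE; apply: ler_sum => i _.
have [_ /andP[al ld]] := Xl i.
have li0 : 0 < l (val i) by exact: lt_le_trans al.
rewrite -powR_mulrn ?(ltW li0)//; apply: ger_powR; last exact: ltW.
by rewrite li0 (le_trans ld)// ltW.
Qed.

Lemma has_intermediate_dim_somewhere_dense (theta : R) : 0 < theta <= 1 ->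
  F `<=` closed_cube 0 2 -> somewhere_dense F ->
  has_intermediate_dim theta F d%:R%:E.
Proof.
move=> theta01 F2 Fd.
have le1 := upper_intermediate_dim_le theta01 F2.
have ge1 := lower_intermediate_dim_ge theta01 Fd.
have le2 := lower_le_upper_intermediate_dim theta.
split; apply/eqP; rewrite eq_le.
  by rewrite le1 (le_trans ge1).
by rewrite ge1 (le_trans le2).
Qed.

Lemma covering_number_le (delta : R) : 0 < delta <= 1 ->
  F `<=` closed_cube 0 2 ->
  (covering_number delta F <= ((grid_const R d / delta) ^+ d)%:E)%E.
Proof.
move=> delta01 F2; have [N [U [NG FU diamU]]] := cube_grid_cover d0 delta01.
apply: ge_ereal_inf; exists N%:R%:E; last by rewrite lee_fin.
exists N => //; exists (fun i => U i); split; last by move=> i; rewrite diamU.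
by move=> x /F2/FU[i /= iN Uix]; exists (Ordinal iN).
Qed.

Lemma covering_number_ge : somewhere_dense F -> exists2 c : R, 0 < c &
  forall delta, 0 < delta ->
    (((c / delta) ^+ d)%:E <= covering_number delta F)%E.
Proof.
move=> /somewhere_dense_ball[p [h [h0 Fh]]].
exists (h / 3) => [|delta delta0]; first by rewrite divr_gt0.
apply/ereal_infP => _ [n [U [FU diamU]] <-]; rewrite lee_fin.
have := dense_cover_volume h0 Fh FU (fun=> delta0) diamU.
rewrite sumr_const card_ord -[_ *+ n]mulr_natl -ler_pdivrMr ?exprn_gt0 ?mulr_gt0//.
by rewrite -expr_div_n invfM mulrA.
Qed.

(** The covering number lies between [(c / delta) ^ d] and [(C / delta) ^ d], so
    its logarithm divided by [- ln delta] differs from [d] by at most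
    [d K / (- ln delta)], where [K] bounds [|ln c|] and [|ln C|]. *)
Lemma has_box_dim_somewhere_dense :
  F `<=` closed_cube 0 2 -> somewhere_dense F -> has_box_dim F d%:R%:E.
Proof.
move=> F2 /covering_number_ge[c c0 cov_ge].
have C0 := @grid_const_gt0 R d; set C := grid_const R d in C0.
apply: limf_squeeze => e e0.
pose K := `|ln c| + `|ln C|.
have K0 : 0 <= K by rewrite addr_ge0.
near=> delta => /=.
have delta0 : 0 < delta by [].
have delta1 : delta < 1 by [].
have lnK : d%:R * K / e < - ln delta.
  have : delta < expR (- (d%:R * K / e)).
    by near: delta; apply: nbhs_right_lt; exact: expR_gt0.
  by rewrite -ltr_ln ?posrE ?expR_gt0// expRK ltrNr.
have L0 : 0 < - ln delta.
  by apply: le_lt_trans lnK; rewrite divr_ge0 ?mulr_ge0// ltW.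
have lo := cov_ge _ delta0.
have hi : (covering_number delta F <= ((C / delta) ^+ d)%:E)%E.
  by apply: covering_number_le => //; rewrite delta0 ltW.
rewrite /box_quotient; case: (covering_number delta F) lo hi => [r| |]//.
rewrite !lee_fin => lo hi.
have cd0 : 0 < (c / delta) ^+ d by rewrite exprn_gt0// divr_gt0.
have r0 : 0 < r by exact: lt_le_trans lo.
have Cd0 : 0 < (C / delta) ^+ d by rewrite exprn_gt0// divr_gt0.
move: lo hi; rewrite -ler_ln ?posrE// -[r <= _]ler_ln ?posrE//.
rewrite !lnXn ?divr_gt0// !ln_div ?posrE//.
rewrite -[(ln c - _) *+ d]mulr_natl.
rewrite -[(ln C - _) *+ d]mulr_natl => lo hi.
rewrite lne_EFin// -EFinM !lee_fin.
rewrite ler_pdivlMr// ler_pdivrMr//.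
move: lnK; rewrite ltr_pdivrMr// => lnK.
have cK : - K <= ln c by rewrite lerNl (le_trans (ler_norm _))// normrN lerDl.
have CK : ln C <= K by rewrite (le_trans (ler_norm _))// lerDr.
have dc : d%:R * - K <= d%:R * ln c by rewrite ler_wpM2l.
have dC : d%:R * ln C <= d%:R * K by rewrite ler_wpM2l.
by apply/andP; split; lra.
Unshelve. all: by end_near. Qed.

End DimensionValues.

(** * Almost sure density *)

Lemma translated_cube_image {R : realType} {d : nat}
    (S : nat -> 'rV[R]_d -> 'rV[R]_d) (t : nat -> 'rV[R]_d) :
  (forall i, S i @` closed_cube 0 2 `<=` closed_cube 0 1) ->
  (forall i, half_open_cube 0 1 (t i)) ->
  forall i, translate S t i @` closed_cube 0 2 `<=` closed_cube 0 2.
Proof.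
move=> S1 t1 i _ [x x2 <-] j; rewrite !mxE.
have /andP[a b] : 0 <= S i x 0 j <= 1 by apply: (S1 i); exists x.
have /andP[a' b'] := t1 i j.
by rewrite addr_ge0//= lerD// ltW.
Qed.

Lemma translated_limit_set_nonempty {R : realType} {d : nat}
    (X : set 'rV[R]_d) (S : nat -> 'rV[R]_d -> 'rV[R]_d)
    (t : nat -> 'rV[R]_d) (rho : R) :
  compact X -> X !=set0 -> 0 <= rho < 1 ->
  (forall i, lipschitz_with X (S i) rho) ->
  (forall i, translate S t i @` X `<=` X) ->
  limit_set X (translate S t) !=set0.
Proof.
move=> cX X0 rho01 lipS TX.
have lipT : lipschitz_with X (translate S t 0) rho.
  move=> x y Xx Xy; rewrite /translate opprD addrACA subrr addr0.
  exact: lipS.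
have [p Xp Tp] := lipschitz_fixed_point cX X0 (TX 0%N) rho01 lipT.
by exists p; exact: limit_set_fixed_point Xp Tp.
Qed.

Lemma ae_translations_hit_infinite_family {R : realType} {d : nat}
    (mu : probability (@seq_rV R d) R) (I : nat -> set nat) :
  is_infinite_product (@lebesgue_unit_cube R d) mu ->
  (forall n N, exists2 i, (N <= i)%N & I n i) ->
  {ae mu, forall t : nat -> 'rV[R]_d, forall n (k : {ffun 'I_d -> 'I_n.+1}),
    exists2 i, I n i & grid_box k (t i)}.
Proof.
move=> hmu infI; apply: ae_foralln => n; apply: ae_countable => k.
exact: ae_translations_hit hmu (infI n).
Qed.

Theorem theorem5p2 (R : realType) (d : nat) (hd : (0 < d)%N)
    (S : nat -> 'rV[R]_d -> 'rV[R]_d)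
    (hS : is_iifs (closed_cube 0 2) S)
    (hS1 : forall i, S i @` closed_cube 0 2 `<=` closed_cube 0 1)
    (hratio : contraction_ratio (closed_cube 0 2) (S i) @[i --> \oo] --> 0)
    (mu : probability (@seq_rV R d) R)
    (hmu : is_infinite_product (@lebesgue_unit_cube R d) mu) :
  {ae mu, forall t : nat -> 'rV[R]_d,
    let F := limit_set (closed_cube 0 2) (translate S t) in
    somewhere_dense F /\
    (forall theta : R, 0 < theta <= 1 ->
       has_intermediate_dim theta F d%:R%:E) /\
    has_box_dim F d%:R%:E}.
Proof.
have [cX _ [x0 [_ [Xx0 _ _]]] SX [rho [rho01 lipS]]] := hS.
have X0 : (closed_cube 0 2 : set 'rV[R]_d) !=set0 by exists x0.
have /andP[rho0 _] := rho01.
have diamX (x y : 'rV[R]_d) : closed_cube 0 2 x -> closed_cube 0 2 y ->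
    enorm (x - y) <= Num.sqrt d%:R * 2.
  move=> x2 y2; apply: enorm_le => // j; rewrite !mxE ler_norml.
  by have := x2 j; have := y2 j => /andP[? ?] /andP[? ?]; lra.
have [c cS] := images_recur cX X0 SX rho0 lipS diamX hratio.
pose I n := [set i | forall x, closed_cube 0 2 x ->
  forall j, `|c 0 j - S i x 0 j| < n.+1%:R^-1].
have infI n N : exists2 i, (N <= i)%N & I n i by apply: cS; rewrite invr_gt0.
apply: ae_imply2 (ae_translations_in_cube hmu)
  (ae_translations_hit_infinite_family hmu infI) => t t1 hit.
set F := limit_set _ _.
have TX := translated_cube_image hS1 t1.
have F2 : F `<=` closed_cube 0 2 := limit_set_sub TX.
have F0 := translated_limit_set_nonempty cX X0 rho01 lipS TX.
have Fdense : somewhere_dense F.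
  (* The centre of the cube c + (0,1)^d. *)
  exists (\row_j (c 0 j + 2^-1)); apply/nbhs_rVP.
  exists 2^-1 => // y yc; apply: (limit_set_dense TX F0 hit) => j.
  by have := yc j; rewrite mxE ltr_norml => /andP[? ?]; lra.
split=> //; split=> [theta theta01|].
  exact: has_intermediate_dim_somewhere_dense.
exact: has_box_dim_somewhere_dense.
Qed.
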